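(* Let $d\ge1$, $q>1$, $\sigma>0$, $w>0$, $x\in\mathbf{R}^d$, $m=\|x\|$, $s=w\sqrt{\log 2}$, and assume $0<s<m$. Let $\mu=N(x,\sigma^2I_d)$, $\nu=N(0,\sigma^2I_d)$, $\mu_0=m-s$, and let $J(\beta)=R_q(\mu'_\beta\|\nu)$, for small $\beta\ge0$, be the function defined in the context. Then $$J'(0)=-\frac{q(q-1)\mu_0^2}{\sigma^2}<0$$ (derivative from the right at $0$), and for all sufficiently small $\beta>0$, $$R^{(w)}_{q}\big(N(x,\sigma^2I_d)\,\big\|\,N(0,\sigma^2I_d)\big)\ \le\ J(\beta)\ <\ \frac{q(m-s)^2}{2\sigma^2}.$$ Consequently the identity $R^{(w)}_{q}(\mu\|\nu)=\frac{q(m-s)_+^2}{2\sigma^2}$ is false for every $q>1$ whenever $0<s<m$.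
   Context: $\|\cdot\|$ is the Euclidean norm on $\mathbf{R}^d$, $N(a,\Sigma)$ is the Gaussian measure with mean $a$ and covariance $\Sigma$, and $t_+=\max(t,0)$. Let $\psi(t)=e^{t^2}-1$ for $t\ge 0$. For an $\mathbf{R}^d$-valued random variable $Z$, $$\|Z\|_\psi:=\inf\{\lambda>0:\ \mathbb{E}\,\psi(\|Z\|/\lambda)\le 1\}$$ (with $\inf\emptyset=+\infty$). For probability measures $\mu,\mu'$ on $\mathbf{R}^d$, with $\Pi(\mu,\mu')$ the set of couplings, $$W_\psi(\mu,\mu')=\inf\{\|X-Y\|_\psi:\ (X,Y)\sim\pi\in\Pi(\mu,\mu')\}.$$ For $q>1$ the Rényi divergence is $$R_q(\mu'\|\nu)=\frac{1}{q-1}\log\int\Big(\frac{d\mu'}{d\nu}\Big)^q d\nu$$ if $\mu'\ll\nu$, and $+\infty$ otherwise. The shifted Rényi divergence is $$R^{(w)}_{q}(\mu\|\nu)=\inf\{R_q(\mu'\|\nu):\ \mu'\text{ a probability measure on }\mathbf{R}^d,\ W_\psi(\mu,\mu')\le w\}.$$ Definition of $\mu'_\beta$ and $J$: let $u=x/m$ and $X\sim\mu$. For small $\beta\ge0$ (in particular $\beta<w/(\sigma\sqrt2)$) let $\mu_D(\beta)\ge0$ be defined by $$\mu_D(\beta)^2=(w^2-2\beta^2\sigma^2)\Big(\log 2+\tfrac12\log\Big(1-\frac{2\beta^2\sigma^2}{w^2}\Big)\Big)$$ (the right-hand side is positive for $\beta$ near $0$, with value $s^2$ at $\beta=0$). Set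 $\alpha(\beta)=\mu_D(\beta)-\beta m$, $D_\beta=(\alpha(\beta)+\beta\langle u,X\rangle)u$, and let $\mu'_\beta$ be the law of $X-D_\beta$. Define $J(\beta):=R_q(\mu'_\beta\|\nu)$. *)

(* Defs.v *)
(* R^d is the type 'rV[R]_d of row vectors over an arbitrary R : realType. *)
From HB Require Import structures.
From mathcomp Require Import all_boot all_order all_algebra.
From mathcomp Require Import all_classical all_reals all_analysis.
From mathcomp Require Import measurable_realfun.

Set Implicit Arguments.
Unset Strict Implicit.
Unset Printing Implicit Defensive.

Import Order.TTheory GRing.Theory Num.Theory.
Import numFieldNormedType.Exports.
Local Open Scope classical_set_scope.
Local Open Scope ring_scope.

(* The library norm `|_| on 'rV[R]_d is the sup norm, hence this definition. *)
Definition dotv (R : realType) (d : nat) (u v : 'rV[R]_d) : R :=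
  \sum_(i < d) u 0 i * v 0 i.

Definition enorm (R : realType) (d : nat) (v : 'rV[R]_d) : R :=
  Num.sqrt (dotv v v).

Definition rV_display : measure_display.
Proof. exact: (measure_tuple_display default_measure_display). Qed.

(* The Borel sigma-algebra of R^d, as the product sigma-algebra, i.e. the one
   generated by the coordinates (as the library does for n.-tuple). *)
Section measurable_rV.
Context (R : realType) (d : nat).

Let coors : 'I_d -> 'rV[R]_d -> R := fun i v => v 0 i.

Let rV_set0 : g_sigma_preimage coors set0.
Proof. exact: sigma_algebra0. Qed.

Let rV_setC A : g_sigma_preimage coors A -> g_sigma_preimage coors (~` A).
Proof. exact: sigma_algebraC. Qed.

Let rV_bigcup (F : _^nat) : (forall i, g_sigma_preimage coors (F i)) ->
  g_sigma_preimage coors (\bigcup_i (F i)).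
Proof. exact: sigma_algebra_bigcup. Qed.

HB.instance Definition _ := @isMeasurable.Build rV_display
  'rV[R]_d (g_sigma_preimage coors) rV_set0 rV_setC rV_bigcup.

End measurable_rV.

Lemma measurable_coord (R : realType) (d : nat) (i : 'I_d) :
  measurable_fun [set: 'rV[R]_d] (fun v : 'rV[R]_d => v 0 i).
Proof.
move=> _ A mA; rewrite setTI; apply: sub_sigma_algebra => /=.
rewrite -bigcup_seq/=; exists i => /=; first by rewrite mem_index_enum.
by exists A => //; rewrite setTI.
Qed.

Lemma measurable_fun_rV d' (T : measurableType d') (R : realType) (d : nat)
    (f : T -> 'rV[R]_d) :
  (forall i, measurable_fun [set: T] (fun t => f t 0 i)) ->
  measurable_fun [set: T] f.
Proof.
move=> mf; pose coors (i : 'I_d) (v : 'rV[R]_d) : R := v 0 i.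
suff prefS : g_sigma_preimage (fun i => coors i \o f) `<=` measurable.
  move=> _ A mA; apply: prefS.
  by rewrite (g_sigma_preimage_comp coors f); exists A.
apply: smallest_sub; first exact: sigma_algebra_measurable.
case: d => [|n] in f mf coors *; first by rewrite big_ord0.
rewrite -bigcup_mkord_ord; apply: bigcup_sub => i Ii.
by move=> A [B mB <-]; exact: mf.
Qed.

(* (t, v) |-> (t, v_0, ..., v_(d-1)) *)
Definition consv (R : realType) (d : nat)
    (z : measurableTypeR R * 'rV[R]_d) : 'rV[R]_d.+1 :=
  \row_(i < d.+1) oapp (z.2 0) z.1 (unlift ord0 i).

Lemma measurable_consv (R : realType) (d : nat) :
  measurable_fun [set: measurableTypeR R * 'rV[R]_d] (@consv R d).
Proof.
apply: measurable_fun_rV => i; under eq_fun do rewrite mxE.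
case: (unlift ord0 i) => [j|] /=; last exact: measurable_fst.
exact: (measurableT_comp (measurable_coord j) measurable_snd).
Qed.
HB.instance Definition _ (R : realType) (d : nat) :=
  isMeasurableFun.Build _ _ _ _ (@consv R d) (@measurable_consv R d).

Definition affv (R : realType) (d : nat) (a : 'rV[R]_d) (A : 'M[R]_d)
    (z : 'rV[R]_d) : 'rV[R]_d := a + z *m A.

Lemma measurable_affv (R : realType) (d : nat) (a : 'rV[R]_d) (A : 'M[R]_d) :
  measurable_fun [set: 'rV[R]_d] (affv a A).
Proof.
apply: measurable_fun_rV => i; under eq_fun do rewrite !mxE.
apply: measurable_funD => //; apply: measurable_sum => j.
by apply: measurable_funM => //; exact: measurable_coord.
Qed.
HB.instance Definition _ (R : realType) (d : nat) (a : 'rV[R]_d) (A : 'M[R]_d) :=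
  isMeasurableFun.Build _ _ _ _ (affv a A) (measurable_affv a A).

(* Law of a vector of d independent N(0, 1) coordinates. *)
Fixpoint std_gaussian (R : realType) (d : nat) : probability 'rV[R]_d R :=
  match d with
  | 0 => dirac (0 : 'rV[R]_0)
  | n.+1 => distribution (normal_prob (0 : R) 1 \x std_gaussian R n)%E (@consv R n)
  end.

(* The symmetric positive semidefinite square root of S (which exists and is
   unique when S is symmetric positive semidefinite; junk value 0 otherwise). *)
Definition sqrtmx (R : realType) (d : nat) (S : 'M[R]_d) : 'M[R]_d :=
  xget 0 [set A | [/\ A^T = A, forall v : 'rV[R]_d, 0 <= dotv (v *m A) v
                    & A *m A = S]].

(* N(a, S), as the law of a + Z S^{1/2} (row vectors) with Z standard. *)
Definition gaussian (R : realType) (d : nat) (a : 'rV[R]_d) (S : 'M[R]_d) :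
    probability 'rV[R]_d R :=
  distribution (std_gaussian R d) (affv a (sqrtmx S)).

Definition psi2 (R : realType) (t : R) : R := expR (t ^+ 2) - 1.

(* Equals +oo when the set is empty. *)
Definition orlicz_norm d' (T : measurableType d') (R : realType) (d : nat)
    (P : probability T R) (Z : T -> 'rV[R]_d) : \bar R :=
  ereal_inf [set lambda%:E | lambda in
    [set lambda : R | 0 < lambda /\
       ('E_P[fun t => psi2 (enorm (Z t) / lambda)] <= 1)%E]].

Definition coupling (R : realType) (d : nat) (mu mu' : probability 'rV[R]_d R)
    (p : probability ('rV[R]_d * 'rV[R]_d)%type R) : Prop :=
  forall A : set 'rV[R]_d, measurable A ->
    pushforward p fst A = mu A /\ pushforward p snd A = mu' A.

Definition Wpsi (R : realType) (d : nat) (mu mu' : probability 'rV[R]_d R) :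
    \bar R :=
  ereal_inf [set orlicz_norm p (fun z : 'rV[R]_d * 'rV[R]_d => z.1 - z.2)
            | p in coupling mu mu'].

Definition renyi d' (T : measurableType d') (R : realType) (q : R)
    (mu nu : probability T R) : \bar R :=
  if `[< mu `<< nu >] then
    ((q - 1)^-1%:E *
     lne (\int[nu]_z (Radon_Nikodym (charge_of_finite_measure mu) nu z `^ q)))%E
  else +oo%E.

Definition shifted_renyi (R : realType) (d : nat) (q w : R)
    (mu nu : probability 'rV[R]_d R) : \bar R :=
  ereal_inf [set renyi q mu' nu
            | mu' in [set mu' : probability 'rV[R]_d R
                     | (Wpsi mu mu' <= w%:E)%E]].

(* The nonnegative root; the radicand is only negative, and muD only a junk
   value, for beta away from 0. *)
Definition muD (R : realType) (sigma w beta : R) : R :=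
  Num.sqrt ((w ^+ 2 - 2 * beta ^+ 2 * sigma ^+ 2) *
    (ln 2 + 2^-1 * ln (1 - 2 * beta ^+ 2 * sigma ^+ 2 / w ^+ 2))).

Definition alpha (R : realType) (d : nat) (sigma w : R) (x : 'rV[R]_d)
    (beta : R) : R :=
  muD sigma w beta - beta * enorm x.

Definition displacement (R : realType) (d : nat) (sigma w : R) (x : 'rV[R]_d)
    (beta : R) (X : 'rV[R]_d) : 'rV[R]_d :=
  let u := (enorm x)^-1 *: x in
  (alpha sigma w x beta + beta * dotv u X) *: u.

Definition displaced (R : realType) (d : nat) (sigma w : R) (x : 'rV[R]_d)
    (beta : R) (X : 'rV[R]_d) : 'rV[R]_d :=
  X - displacement sigma w x beta X.

Lemma measurable_displaced (R : realType) (d : nat) (sigma w : R)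
    (x : 'rV[R]_d) (beta : R) :
  measurable_fun [set: 'rV[R]_d] (displaced sigma w x beta).
Proof.
apply: measurable_fun_rV => i.
under eq_fun do rewrite /displaced /displacement !mxE.
apply: measurable_funB; first exact: measurable_coord.
apply: measurable_funM => //; apply: measurable_funD => //.
apply: measurable_funM => //; apply: measurable_sum => j.
by apply: measurable_funM => //; exact: measurable_coord.
Qed.
HB.instance Definition _ (R : realType) (d : nat) (sigma w : R)
    (x : 'rV[R]_d) (beta : R) :=
  isMeasurableFun.Build _ _ _ _ (displaced sigma w x beta)
    (measurable_displaced sigma w x beta).

Definition mu_beta (R : realType) (d : nat) (sigma w : R) (x : 'rV[R]_d)
    (beta : R) : probability 'rV[R]_d R :=
  distribution (gaussian x (sigma ^+ 2)%:M) (displaced sigma w x beta).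

Definition Jfun (R : realType) (d : nat) (q sigma w : R) (x : 'rV[R]_d)
    (beta : R) : \bar R :=
  renyi q (mu_beta sigma w x beta) (gaussian 0 (sigma ^+ 2)%:M).

(* J has right derivative l at a: J is extended-real valued, so this includes
   the finiteness of J at a and on a right neighbourhood of a. *)
Definition is_right_derive (R : realType) (J : R -> \bar R) (a l : R) : Prop :=
  [/\ J a \is a fin_num,
      \forall b \near a^'+, J b \is a fin_num
    & (fine (J b) - fine (J a)) / (b - a) @[b --> a^'+] --> l].

(* Main.v *)
(* Along u = x/m the displacement is D = (muD + beta sigma Z) u with Z ~ N(0,1),
   and muD(beta) is exactly the value for which E exp(|D|^2 / w^2) = 2; hence
   mu'_beta stays within W_psi distance w of mu.  The law mu'_beta differs from
   nu only along u, where it is N(m - muD, (1 - beta)^2 sigma^2), so J is a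
   one-dimensional Gaussian Renyi divergence,
     J = q (m - muD)^2 / (2 sigma^2 V) - ln c - ln V / (2 (q - 1)),
     c = 1 - beta,  V = c^2 + q (1 - c^2).
   As muD'(0) = 0, shrinking the variance at zero first-order cost in the mean
   makes J strictly decrease at 0.  The reduction to one dimension rests on
   Z and (Z - <u,Z> u) + g u having the same law for Z standard Gaussian,
   g ~ N(0,1) independent of Z and u a unit vector. *)
From HB Require Import structures.
Require Import Defs.
From mathcomp Require Import all_boot all_order all_algebra.
From mathcomp Require Import all_classical all_reals all_analysis.
From mathcomp Require Import measurable_realfun.
From mathcomp Require Import ring lra.

Set Implicit Arguments.
Unset Strict Implicit.
Unset Printing Implicit Defensive.

Import Order.TTheory GRing.Theory Num.Theory.
Import numFieldNormedType.Exports.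
Local Open Scope classical_set_scope.
Local Open Scope ring_scope.

(** * Densities and Gaussian integrals on the line *)

Section density.
Context d (T : measurableType d) (R : realType).
Variables (P : {finite_measure set T -> \bar R}).
Variables (mu : {sigma_finite_measure set T -> \bar R}) (g : T -> R).
Hypotheses (mg : measurable_fun [set: T] g) (g0 : forall x, 0 <= g x).
Hypothesis Pg : forall A, measurable A -> P A = (\int[mu]_(x in A) (g x)%:E)%E.

Lemma density_dominates : P `<< mu.
Proof.
apply/null_content_dominatesP => A mA muA0; rewrite Pg//.
apply: null_set_integral => //.
exact/measurable_EFinP/measurable_funTS.
Qed.

(** Both functions integrate to [P E] over every measurable [E], and an integrable function is
    determined almost everywhere by these integrals. *)
Lemma ae_eq_density :
  ae_eq mu [set: T] (Radon_Nikodym (charge_of_finite_measure P) mu) (EFin \o g).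
Proof.
apply: integral_ae_eq => //.
- by apply: Radon_Nikodym_integrable; exact: density_dominates.
- exact/measurable_EFinP.
- move=> E _ mE.
  rewrite -Pg// -(@Radon_Nikodym_integral _ _ _ (charge_of_finite_measure P))//.
  exact: density_dominates.
Qed.

Lemma ge0_integral_density (f : T -> \bar R) :
  measurable_fun [set: T] f -> (forall x, 0 <= f x)%E ->
  (\int[P]_x f x = \int[mu]_x (f x * (g x)%:E))%E.
Proof.
move=> mf f0.
rewrite -(Radon_Nikodym_SigmaFinite.change_of_variables density_dominates)//.
apply: ge0_ae_eq_integral => //.
- apply: emeasurable_funM => //.
  apply: measurable_int.
  exact: (Radon_Nikodym_SigmaFinite.f_integrable density_dominates).
- exact/emeasurable_funM/measurable_EFinP.
- move=> x _; apply: mule_ge0 => //.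
  exact: Radon_Nikodym_SigmaFinite.f_ge0 density_dominates x.
- by move=> x _; rewrite mule_ge0 ?lee_fin.
- apply: ae_eqe_mul2l; apply: ae_eq_trans ae_eq_density.
  exact: (ae_eq_Radon_Nikodym_SigmaFinite density_dominates).
Qed.

End density.

(** * Lebesgue measure under affine maps of the line *)

Section lebesgue_affine.
Context {R : realType}.
Local Notation mu := (@lebesgue_measure R).
Variables (a b : R).
Hypothesis a0 : a != 0.

Let aff (x : measurableTypeR R) : measurableTypeR R := a * x + b.

Let maff : measurable_fun [set: measurableTypeR R] aff.
Proof. by apply: measurable_funD => //; exact: measurable_funM. Qed.

Let norm_a_ge0 : 0 <= `|a|. Proof. exact: normr_ge0. Qed.

Let nu : {measure set (measurableTypeR R) -> \bar R} :=
  mscale (NngNum norm_a_ge0)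
    (measure_function_pushforward__canonical__measure_function_Measure mu maff).

(** The right-hand side is the measure [nu]; by uniqueness of Lebesgue measure it suffices to
    compare lengths of intervals []l, r]]. *)
Lemma lebesgue_measure_affine A : measurable A ->
  mu A = (`|a|%:E * pushforward mu aff A)%E.
Proof.
move=> mA.
rewrite (@lebesgue_measure_unique R nu _ A mA)//.
move=> _ [[l r] /= lr <-]; rewrite /nu/= /mscale/= /pushforward.
have [ap|an|a00] := ltgtP 0 a; last by move: a0; rewrite -a00 eqxx.
- have -> : aff @^-1` `]l, r]%classic = `](l - b) / a, (r - b) / a]%classic.
    apply/seteqP; split => x; rewrite /= !in_itv/= ltr_pdivrMr// ler_pdivlMr//;
      rewrite /aff mulrC => /andP[? ?]; apply/andP; split; lra.
  rewrite !lebesgue_measure_itv/= !lte_fin ltr_pM2r ?invr_gt0// ltrD2r.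
  case: ifPn => _; last by rewrite mule0.
  rewrite (gtr0_norm ap) -!EFinB -EFinM; congr EFin; field.
  by rewrite gt_eqF.
(* A negative slope reverses the interval, so the closed end moves to the left; the length is
   unaffected. *)
- have -> : aff @^-1` `]l, r]%classic = `[(r - b) / a, (l - b) / a[%classic.
    apply/seteqP; split => x; rewrite /= !in_itv/= ltr_ndivlMr// ler_ndivrMr//;
      rewrite /aff mulrC => /andP[? ?]; apply/andP; split; lra.
  rewrite !lebesgue_measure_itv/= !lte_fin ltr_nM2r ?invr_lt0// ltrD2r.
  case: ifPn => _; last by rewrite mule0.
  rewrite (ltr0_norm an) -!EFinB -EFinM; congr EFin; field.
  by rewrite lt_eqF.
Qed.

Lemma ge0_integral_affine (f : measurableTypeR R -> \bar R) :
  measurable_fun [set: measurableTypeR R] f -> (forall x, 0 <= f x)%E ->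
  (\int[mu]_x f (a * x + b)%R * `|a|%:E = \int[mu]_x f x)%E.
Proof.
move=> mf f0; transitivity (\int[nu]_x f x)%E.
  rewrite ge0_integral_mscale//= muleC; congr (_ * _)%E.
  by rewrite (ge0_integral_pushforward maff).
by apply: eq_measure_integral => A mA _; exact/esym/lebesgue_measure_affine.
Qed.

End lebesgue_affine.

(** * Gaussian integrals on the line and in the plane *)

Section gaussian_line.
Context {R : realType}.
Local Notation mu := (@lebesgue_measure R).
Local Notation N := (@normal_prob R 0 1).
Let phi (x : R) : R := normal_pdf 0 1 x.

Let phiE x : phi x = normal_peak 1 * expR (- (x ^+ 2 / 2)).
Proof.
rewrite /phi normal_pdfE ?oner_eq0//; congr (_ * expR _).
by rewrite expr1n subr0 mulNr.
Qed.

Let mphi : measurable_fun [set: measurableTypeR R] phi.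
Proof. exact: measurable_normal_pdf. Qed.

Let phi_ge0 x : 0 <= phi x. Proof. exact: normal_pdf_ge0. Qed.

Lemma ge0_integral_normal (f : measurableTypeR R -> \bar R) :
  measurable_fun [set: measurableTypeR R] f -> (forall x, 0 <= f x)%E ->
  (\int[N]_x f x = \int[mu]_x (f x * (normal_pdf 0 1 x)%:E))%E.
Proof.
by apply: ge0_integral_density.
Qed.

(** Under N(0,1) the law of [c * x + b] is N(b, c^2), and the factor on the right is the density of
    that law relative to N(0,1). The proof passes to Lebesgue measure, substitutes there and
    returns. *)
Lemma ge0_integral_normal_affine (c b : R)
    (f : measurableTypeR R -> \bar R) : 0 < c ->
  measurable_fun [set: measurableTypeR R] f -> (forall x, 0 <= f x)%E ->
  (\int[N]_x f (c * x + b)%R =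
   \int[N]_x (f x * (c^-1 * expR (x ^+ 2 / 2 - ((x - b) / c) ^+ 2 / 2))%:E))%E.
Proof.
move=> c0 mf f0.
have maff : measurable_fun [set: measurableTypeR R]
    ((fun x => c * x + b) : measurableTypeR R -> measurableTypeR R).
  by apply: measurable_funD => //; exact: measurable_funM.
have maff' : measurable_fun [set: measurableTypeR R]
    ((fun x => (x - b) / c) : measurableTypeR R -> measurableTypeR R).
  by apply: measurable_funM => //; exact: measurable_funB.
rewrite ge0_integral_normal//=; last exact: measurableT_comp mf maff.
rewrite ge0_integral_normal//=; first last.
- by move=> x; rewrite mule_ge0// lee_fin mulr_ge0 ?expR_ge0// invr_ge0 ltW.
- apply: emeasurable_funM => //; apply/measurable_EFinP.
  apply: measurable_funM => //; apply: measurableT_comp => //.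
  by apply: measurable_funB; apply: measurable_funM => //; apply: measurable_funX.
pose G x : \bar R := (f x * (c^-1 * phi ((x - b) / c))%:E)%E.
transitivity (\int[mu]_x G x)%E; last first.
  apply: eq_integral => x _; rewrite /G -muleA -EFinM; congr (_ * _%:E)%E.
  rewrite -/(phi x) -mulrA; congr (_ * _).
  by rewrite !phiE mulrCA -expRD; congr (_ * expR _); lra.
rewrite -(@ge0_integral_affine R c b)//; first last.
- by move=> x; rewrite mule_ge0// lee_fin mulr_ge0// invr_ge0 ltW.
- apply: emeasurable_funM => //; apply/measurable_EFinP.
  by apply: measurable_funM => //; exact: measurableT_comp.
- by rewrite gt_eqF.
rewrite -ge0_integralZr//; first last.
- by move=> x _; rewrite mule_ge0// lee_fin mulr_ge0// invr_ge0 ltW.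
- apply: emeasurable_funM; first exact: measurableT_comp mf maff.
  apply/measurable_EFinP; apply: measurable_funM => //.
  apply: measurableT_comp => //; apply: measurable_funM => //.
  exact: measurable_funB.
apply: eq_integral => x _; rewrite /G -muleA -EFinM gtr0_norm//.
rewrite mulrAC mulVf ?gt_eqF// mul1r; congr (_ * (phi _)%:E)%E.
by field; rewrite gt_eqF.
Qed.

(** Completing the square: the integrand is the constant [K] times the density of N(b, c^2) relative
    to N(0,1), with [b = B / (1 + A)] and [c ^+ 2 = (1 + A)^-1]. The affine formula, read backwards
    for the constant function [K], gives the value. *)
Lemma integral_normal_expR_quadratic (A B : R) : - 1 < A ->
  (\int[N]_x (expR (B * x - A * x ^+ 2 / 2))%:E =
   ((Num.sqrt (1 + A))^-1 * expR (B ^+ 2 / (2 * (1 + A))))%:E)%E.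
Proof.
move=> A1.
have D0 : 0 < 1 + A by lra.
pose c := (Num.sqrt (1 + A))^-1; pose b := B / (1 + A).
have c0 : 0 < c by rewrite invr_gt0 sqrtr_gt0.
have c2 : c ^+ 2 = (1 + A)^-1 by rewrite /c exprVn sqr_sqrtr// ltW.
pose K := c * expR (B ^+ 2 / (2 * (1 + A))).
have K0 : 0 <= K by rewrite mulr_ge0 ?expR_ge0// ltW.
transitivity (\int[N]_x (K%:E *
  (c^-1 * expR (x ^+ 2 / 2 - ((x - b) / c) ^+ 2 / 2))%:E))%E.
  apply: eq_integral => x _; rewrite -EFinM; congr EFin.
  rewrite /K mulrACA mulfV ?gt_eqF// mul1r -expRD; congr expR.
  rewrite exprMn exprVn c2 invrK /b; field.
  by rewrite gt_eqF.
by rewrite -(@ge0_integral_normal_affine c b (cst K%:E))//= integral_cst//=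
  probability_setT mule1.
Qed.

Let integral_normal2 (F : measurableTypeR R * measurableTypeR R -> \bar R) :
  measurable_fun [set: measurableTypeR R * measurableTypeR R] F ->
  (forall z, 0 <= F z)%E ->
  (\int[N]_x \int[N]_y F (x, y) =
   \int[mu]_x \int[mu]_y (F (x, y) * (phi x * phi y)%:E))%E.
Proof.
move=> mF F0.
rewrite ge0_integral_normal//; first last.
- by move=> x; exact: integral_ge0.
- exact: (measurable_fun_fubini_tonelli_F F).
apply: eq_integral => x _.
rewrite ge0_integral_normal//; last exact: measurableT_comp.
rewrite -ge0_integralZr//; first last.
- by rewrite lee_fin.
- by move=> y _; rewrite mule_ge0// lee_fin.
- apply: emeasurable_funM; first exact: measurableT_comp.
  exact/measurable_EFinP.
by apply: eq_integral => y _; rewrite -muleA -EFinM mulrC.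
Qed.

(** The product density depends only on x^2 + y^2, which rotations preserve. The rotation is
    performed as two one-dimensional affine substitutions separated by Tonelli's theorem; each has
    slope [b] or its inverse up to sign, whence [b != 0]. *)
Lemma ge0_integral_normal_rotation (a b : R)
    (F : measurableTypeR R * measurableTypeR R -> \bar R) :
  a ^+ 2 + b ^+ 2 = 1 -> b != 0 ->
  measurable_fun [set: measurableTypeR R * measurableTypeR R] F ->
  (forall z, 0 <= F z)%E ->
  (\int[N]_x \int[N]_y F (a * x - b * y, b * x + a * y)%R =
   \int[N]_x \int[N]_y F (x, y))%E.
Proof.
move=> ab1 b0 mF F0.
pose rot (z : measurableTypeR R * measurableTypeR R) :
  measurableTypeR R * measurableTypeR R :=
  (a * z.1 - b * z.2, b * z.1 + a * z.2).
have mpair_aff (x c e : measurableTypeR R) : measurable_fun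
    [set: measurableTypeR R] (fun y : measurableTypeR R => (x, c * y + e)).
  apply: measurable_fun_pair => //.
  by apply: measurable_funD => //; exact: measurable_funM.
have mrot : measurable_fun setT rot.
  apply/measurable_fun_pairP; split.
    by apply: measurable_funB; apply: measurable_funM.
  by apply: measurable_funD; apply: measurable_funM.
rewrite (@integral_normal2 (F \o rot))//; first last.
- by move=> z /=.
- exact: measurableT_comp.
rewrite integral_normal2//.
(* Integrand after the first substitution: with [x] fixed, [y] is replaced by t = a x - b y, so that
   b x + a y becomes (x - a t) / b. *)
pose K (z : measurableTypeR R * measurableTypeR R) :=
  (F (z.2, (z.1 - a * z.2) / b)%R *
   (phi z.1 * phi ((a * z.1 - z.2) / b) * `|- b^-1|)%:E)%E.
have K0 z : (0 <= K z)%E by rewrite mule_ge0// lee_fin !mulr_ge0.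
have mK : measurable_fun setT K.
  apply: emeasurable_funM.
    apply: measurableT_comp => //; apply: measurable_fun_pair;
      first exact: measurable_snd.
    apply: measurable_funM => //; apply: measurable_funB => //.
    exact: measurable_funM.
  apply/measurable_EFinP; apply: measurable_funM => //.
  apply: measurable_funM; apply: measurableT_comp => //.
  apply: measurable_funM => //; apply: measurable_funB => //.
  exact: measurable_funM.
transitivity (\int[mu]_x \int[mu]_y K (x, y))%E.
  apply: eq_integral => x _.
  rewrite -(@ge0_integral_affine R (- b^-1) (a * x / b))//; first last.
  - by move=> y; apply: mule_ge0; rewrite /= ?lee_fin ?mulr_ge0.
  - apply: emeasurable_funM; last first.
      by apply/measurable_EFinP; apply: measurable_funM.
    by apply: measurableT_comp => //; exact: measurableT_comp.
  - by rewrite oppr_eq0 invr_eq0.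
  rewrite -ge0_integralZr//; first last.
  - by move=> y _; apply: mule_ge0; rewrite /= ?lee_fin ?mulr_ge0.
  - apply: emeasurable_funM.
      exact: measurableT_comp mF (measurableT_comp mrot (mpair_aff _ _ _)).
    apply/measurable_EFinP; apply: measurable_funM => //.
    apply: measurableT_comp => //.
    by apply: measurable_funD => //; exact: measurable_funM.
  apply: eq_integral => y _; rewrite /K -muleA -EFinM /rot/=.
  have -> : a * x - b * (- b^-1 * y + a * x / b) = y by field.
  have -> : - b^-1 * y + a * x / b = (a * x - y) / b by field.
  have -> // : b * x + a * ((a * x - y) / b) = (x - a * y) / b.
  by apply: (mulIf b0); rewrite divfK// -[in RHS](mul1r x) -ab1; field.
transitivity (\int[mu]_y \int[mu]_x K (x, y))%E.
  exact: (@fubini_tonelli _ _ _ _ R mu mu K mK K0).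
apply: eq_integral => x _.
have mswap_aff : measurable_fun [set: measurableTypeR R]
    (fun y : measurableTypeR R => (b * y + a * x, x)).
  apply: measurable_fun_pair => //.
  by apply: measurable_funD => //; exact: measurable_funM.
(* Second substitution: after the exchange [x] names the first argument of [F], and the other
   variable is replaced by [b * y + a * x], making the second argument of [F] equal to [y]. The two
   Jacobians cancel. *)
rewrite -(@ge0_integral_affine R b (a * x))//; last exact: measurableT_comp.
rewrite -ge0_integralZr//; last exact: measurableT_comp mK mswap_aff.
apply: eq_integral => y _; rewrite /K/= -muleA -EFinM.
have -> : (b * y + a * x - a * x) / b = y by field.
congr (_ * _%:E)%E.
rewrite -(mulrA (_ * _)) -normrM mulNr mulVf// normrN1 mulr1 !phiE.
rewrite mulrACA [RHS]mulrACA; congr (_ * _).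
rewrite -!expRD; congr expR.
have -> : (a * (b * y + a * x) - x) / b = a * y - b * x.
  by apply: (mulIf b0); rewrite divfK// -[X in _ - X](mul1r x) -ab1; ring.
transitivity (- ((a ^+ 2 + b ^+ 2) * (x ^+ 2 + y ^+ 2) / 2)); first by field.
by rewrite ab1; field.
Qed.
End gaussian_line.

(** * The standard Gaussian vector *)

Section dotv_theory.
Context {R : realType} {d : nat}.
Implicit Types (u v z : 'rV[R]_d) (k : R).

Lemma dotvC u v : dotv u v = dotv v u.
Proof. by apply: eq_bigr => i _; rewrite mulrC. Qed.

Lemma dotvDr u v z : dotv u (v + z) = dotv u v + dotv u z.
Proof. by rewrite -big_split; apply: eq_bigr => i _; rewrite !mxE mulrDr. Qed.

Lemma dotvZr k u v : dotv u (k *: v) = k * dotv u v.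
Proof. by rewrite mulr_sumr; apply: eq_bigr => i _; rewrite !mxE mulrCA. Qed.

Lemma dotvZl k u v : dotv (k *: u) v = k * dotv u v.
Proof. by rewrite dotvC dotvZr dotvC. Qed.

Lemma dotvv_ge0 u : 0 <= dotv u u.
Proof. by apply: sumr_ge0 => i _; rewrite -expr2 sqr_ge0. Qed.

Lemma dotvv_eq0 u : dotv u u = 0 -> u = 0.
Proof.
move=> /eqP; rewrite psumr_eq0; last by move=> i _; rewrite -expr2 sqr_ge0.
move=> /allP h; apply/rowP => i; rewrite !mxE; apply/eqP.
by have := h i (mem_index_enum _); rewrite /= mulf_eq0 orbb.
Qed.

Lemma enorm_sq u : enorm u ^+ 2 = dotv u u.
Proof. by rewrite sqr_sqrtr// dotvv_ge0. Qed.

Lemma enormZ k u : enorm (k *: u) = `|k| * enorm u.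
Proof.
by rewrite /enorm dotvZl dotvZr mulrA -expr2 sqrtrM ?sqr_ge0// sqrtr_sqr.
Qed.

End dotv_theory.

Section measurable_vector.
Context d' (T : measurableType d') {R : realType} {d : nat}.

Lemma measurable_addv (f g : T -> 'rV[R]_d) :
  measurable_fun [set: T] f -> measurable_fun [set: T] g ->
  measurable_fun [set: T] (fun t => f t + g t).
Proof.
move=> mf mg; apply: measurable_fun_rV => i; under eq_fun do rewrite mxE.
by apply: measurable_funD; exact: measurableT_comp (measurable_coord i) _.
Qed.

Lemma measurable_scalev (k : T -> R) (f : T -> 'rV[R]_d) :
  measurable_fun [set: T] k -> measurable_fun [set: T] f ->
  measurable_fun [set: T] (fun t => k t *: f t).
Proof.
move=> mk mf; apply: measurable_fun_rV => i; under eq_fun do rewrite mxE.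
by apply: measurable_funM => //; exact: measurableT_comp (measurable_coord i) _.
Qed.

Lemma measurable_dotv (u : 'rV[R]_d) (f : T -> 'rV[R]_d) :
  measurable_fun [set: T] f -> measurable_fun [set: T] (fun t => dotv u (f t)).
Proof.
move=> mf; apply: measurable_sum => i; apply: measurable_funM => //.
exact: measurableT_comp (measurable_coord i) _.
Qed.

End measurable_vector.

Section consv_theory.
Context {R : realType} {d : nat}.
Implicit Types (x y : R) (u v : 'rV[R]_d).

Lemma consvD x y u v : consv (x + y, u + v) = consv (x, u) + consv (y, v).
Proof.
by apply/rowP => i; rewrite !mxE; case: unlift => [j|]//=; rewrite mxE.
Qed.

Lemma consvZ k x u : consv (k * x, k *: u) = k *: consv (x, u).
Proof.
by apply/rowP => i; rewrite !mxE; case: unlift => [j|]//=; rewrite mxE.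
Qed.

Lemma dotv_consv x y u v :
  dotv (consv (x, u)) (consv (y, v)) = x * y + dotv u v.
Proof.
rewrite /dotv big_ord_recl !mxE unlift_none/=; congr (_ + _).
by apply: eq_bigr => i _; rewrite !mxE liftK.
Qed.

Lemma consv_surj (z : 'rV[R]_d.+1) : exists x u, z = consv (x, u).
Proof.
exists (z 0 0), (\row_i z 0 (lift 0 i)); apply/rowP => i.
by rewrite !mxE; case: unliftP => [j ->|->]//=; rewrite mxE.
Qed.

End consv_theory.

(** * Splitting the standard Gaussian vector along a unit vector *)

Section std_gaussian_theory.
Context {R : realType}.
Local Notation N := (@normal_prob R 0 1).

Lemma ge0_integral_std_gaussianS n (f : 'rV[R]_n.+1 -> \bar R) :
  measurable_fun [set: 'rV[R]_n.+1] f -> (forall z, 0 <= f z)%E ->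
  (\int[std_gaussian R n.+1]_z f z =
   \int[N]_x \int[std_gaussian R n]_v f (consv (x, v)))%E.
Proof.
move=> mf f0; rewrite /= ge0_integral_distribution//.
rewrite (fubini_tonelli1 (f \o @consv R n))//; last by move=> z /=.
by apply: measurableT_comp => //; exact: measurable_consv.
Qed.

Lemma integral_probability_cst d (T : measurableType d) (P : probability T R)
  (c : \bar R) : (\int[P]_x c = c)%E.
Proof.
by have := integral_cst P measurableT c; rewrite /= probability_setT mule1.
Qed.

(** Symmetry of N(0,1), read off from the quarter turn (x, y) -> (-y, x) applied to a function of
    the first coordinate. *)
Let integral_normal_opp (f : measurableTypeR R -> \bar R) :
  measurable_fun [set: measurableTypeR R] f -> (forall x, 0 <= f x)%E ->
  (\int[N]_x f (- x)%R = \int[N]_x f x)%E.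
Proof.
move=> mf f0; pose F (z : measurableTypeR R * measurableTypeR R) := f z.1.
have mF : measurable_fun setT F by exact: measurableT_comp.
have := @ge0_integral_normal_rotation R 0 1 F.
rewrite expr0n expr1n add0r => /(_ erefl (oner_neq0 _) mF (fun z => f0 _)).
rewrite /F/= => h.
transitivity (\int[N]_x \int[N]_y f (0 * x - 1 * y)%R)%E.
  rewrite -[LHS](@integral_probability_cst _ _ N).
  apply: eq_integral => x _; apply: eq_integral => y _.
  by rewrite mul0r mul1r sub0r.
by rewrite h; apply: eq_integral => x _; rewrite integral_probability_cst.
Qed.

Lemma measurable_consv_comp d' (T : measurableType d') n
    (k : T -> measurableTypeR R) (h : T -> 'rV[R]_n) :
  measurable_fun [set: T] k -> measurable_fun [set: T] h ->
  measurable_fun [set: T] (fun t => consv (k t, h t)).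
Proof.
move=> mk mh; apply: (measurableT_comp (@measurable_consv R n)).
exact: measurable_fun_pair.
Qed.

(* For u = (u0, r v), splitting off v by induction leaves the invariance of
   N(0,1) x N(0,1) under the planar rotation taking (1, 0) to (u0, r). *)
Lemma ge0_integral_std_gaussian_split n (u : 'rV[R]_n)
    (f : 'rV[R]_n -> \bar R) : dotv u u = 1 ->
  measurable_fun [set: 'rV[R]_n] f -> (forall z, 0 <= f z)%E ->
  (\int[std_gaussian R n]_z f z =
   \int[N]_g \int[std_gaussian R n]_z f (z + (g - dotv u z) *: u)%R)%E.
Proof.
elim: n u f => [|n IH] u f u1 mf f0.
  by move: u1; rewrite /dotv big_ord0 => /eqP; rewrite eq_sym oner_eq0.
rewrite ge0_integral_std_gaussianS//.
have mfg (g : R) : measurable_fun [set: 'rV[R]_n.+1]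
    (fun z : 'rV[R]_n.+1 => f (z + (g - dotv u z) *: u)).
  apply: measurableT_comp => //; apply: measurable_addv => //.
  apply: measurable_scalev => //; apply: measurable_funB => //.
  exact: measurable_dotv.
under [in RHS]eq_integral do rewrite ge0_integral_std_gaussianS//.
have [u0 [u' def_u]] := consv_surj u.
move: u1; rewrite def_u dotv_consv => u1.
(* If [u'] vanishes then [u0] is 1 or -1, and the split merely replaces the first coordinate by
   [u0 * g]; symmetry of N(0,1) suffices. *)
have [r0|r0] := eqVneq (dotv u' u') 0.

  have u'0 : u' = 0 by exact: dotvv_eq0.
  have u0sq : u0 ^+ 2 = 1 by rewrite -u1 r0 addr0 expr2.
  pose H g := (\int[std_gaussian R n]_v f (consv (g, v)))%E.
  have mH : measurable_fun [set: measurableTypeR R] H.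
    apply: (measurable_fun_fubini_tonelli_F (f \o @consv R n)) => [|z /=//].
    by apply: measurableT_comp => //; exact: measurable_consv.
  have H0 g : (0 <= H g)%E by apply: integral_ge0.
  transitivity (\int[N]_g H (u0 * g)%R)%E.
    have /orP[/eqP ->|/eqP ->] : (u0 == 1) || (u0 == -1).
      by rewrite -eqf_sqr u0sq expr1n.
      by apply: eq_integral => g _; rewrite mul1r.
    by rewrite -integral_normal_opp//; apply: eq_integral => g _; rewrite mulN1r.
  apply: eq_integral => g _; rewrite -[LHS](@integral_probability_cst _ _ N).
  apply: eq_integral => x _; apply: eq_integral => v _; congr (f _).
  rewrite u'0 dotv_consv dotvC -(scale0r 0) dotvZr mul0r addr0 -consvZ -consvD.
  congr (consv (_, _)); last by rewrite scale0r scaler0 addr0.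
  by rewrite mulrBl mulrAC -expr2 u0sq mul1r addrC subrK mulrC.
pose r := enorm u'.
have r_neq0 : r != 0.
  by apply: contra r0 => /eqP r00; rewrite -enorm_sq -/r r00 expr0n.
have [v [u'E v1]] : exists v, u' = r *: v /\ dotv v v = 1.
  exists (r^-1 *: u'); rewrite scalerA mulfV// scale1r; split => //.
  by rewrite dotvZl dotvZr -enorm_sq -/r; field.
have ur1 : u0 ^+ 2 + (- r) ^+ 2 = 1 by rewrite sqrrN enorm_sq -u1 expr2.
(* The induction hypothesis along [v] turns the left-hand side into a planar integral of [F (x, h)],
   where [x] is the first coordinate and [h] the component along [v]. *)
pose Fz (z : (measurableTypeR R * measurableTypeR R) * 'rV[R]_n) :=
  f (consv (z.1.1, z.2 + (z.1.2 - dotv v z.2) *: v)).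
have mFz : measurable_fun setT Fz.
  apply: measurableT_comp => //; apply: measurable_consv_comp.
    exact: measurableT_comp.
  apply: measurable_addv => //; apply: measurable_scalev => //.
  apply: measurable_funB; first exact: measurableT_comp.
  exact: measurable_dotv.
pose F z := (\int[std_gaussian R n]_y Fz (z, y))%E.
have F0 z : (0 <= F z)%E by apply: integral_ge0 => y _; exact: f0.
have mF : measurable_fun setT F.
  by apply: (measurable_fun_fubini_tonelli_F Fz) => // z; exact: f0.
transitivity (\int[N]_x \int[N]_h F (x, h))%E.
  apply: eq_integral => x _.
  rewrite (IH v (fun z => f (consv (x, z)))) => //.
  by apply: measurableT_comp => //; exact: measurable_consv_comp.

have ur1' : u0 ^+ 2 + r ^+ 2 = 1 by rewrite -ur1 sqrrN.
(* In the rotated plane [g] is the component along [u] and [k] the one orthogonal to it. *)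
transitivity
  (\int[N]_g \int[N]_k F (u0 * g - r * k, r * g + u0 * k)%R)%E.
  exact/esym/(ge0_integral_normal_rotation ur1' r_neq0 mF F0).
apply: eq_integral => g _.
pose Phi (z : measurableTypeR R * measurableTypeR R) :=
  F (u0 * g - r * z.2, r * g + u0 * z.2).
have mPhi : measurable_fun setT Phi.
  apply: measurableT_comp => //; apply: measurable_fun_pair => //.
    by apply: measurable_funB => //; exact: measurable_funM.
  by apply: measurable_funD => //; exact: measurable_funM.
(* For fixed [g] the integrand depends on [k] alone, so a dummy Gaussian variable can be added. The
   next rotation writes [k] as [- r * x + u0 * h], the component orthogonal to [u] of a fresh pair
   [(x, h)]. *)
transitivity (\int[N]_x \int[N]_h Phi (x, h))%E.
  by rewrite -[LHS](@integral_probability_cst _ _ N).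
have rN_neq0 : - r != 0 by rewrite oppr_eq0.
transitivity
  (\int[N]_x \int[N]_h Phi (u0 * x - (- r) * h, (- r) * x + u0 * h)%R)%E.
  exact/esym/(ge0_integral_normal_rotation ur1 rN_neq0 mPhi (fun z => F0 _)).
apply: eq_integral => x _.
pose fg (z : 'rV[R]_n) := f (consv (x, z) +
  (g - dotv (consv (u0, u')) (consv (x, z))) *: consv (u0, u')).
have mfx : measurable_fun [set: 'rV[R]_n] fg.
  rewrite /fg -def_u; apply: (measurableT_comp (mfg g)).
  exact: measurable_consv_comp.
(* The induction hypothesis, now used in reverse, reassembles [h] and the rest into a full standard
   vector. *)
transitivity
  (\int[N]_h \int[std_gaussian R n]_z fg (z + (h - dotv v z) *: v)%R)%E;
  last exact/esym/(IH v fg v1 mfx (fun z => f0 _)).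
apply: eq_integral => h _; apply: eq_integral => y _; rewrite /Fz /fg/=.
congr (f _).
rewrite dotv_consv u'E dotvZl dotvDr dotvZr v1 mulr1 subrKC.
rewrite -consvZ -consvD scalerA -(addrA y) -scalerDl.
congr (consv (_, _ + _ *: v)).
  by rewrite -[X in X + _ * u0](mul1r x) -ur1; ring.
by rewrite -[X in X - _ + _ * r](mul1r h) -ur1; ring.
Qed.

End std_gaussian_theory.

Section std_gaussian_direction.
Context {R : realType} {d : nat}.
Local Notation N := (@normal_prob R 0 1).
Variable u : 'rV[R]_d.
Hypothesis u1 : dotv u u = 1.

Let dotv_split g z : dotv u (z + (g - dotv u z) *: u) = g.
Proof. by rewrite dotvDr dotvZr u1 mulr1 subrKC. Qed.

Lemma ge0_integral_std_gaussian_dotv (f : measurableTypeR R -> \bar R) :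
  measurable_fun [set: measurableTypeR R] f -> (forall x, 0 <= f x)%E ->
  (\int[std_gaussian R d]_z f (dotv u z) = \int[N]_t f t)%E.
Proof.
move=> mf f0; rewrite (ge0_integral_std_gaussian_split u1)//; last first.
  by apply: measurableT_comp => //; exact: measurable_dotv.
apply: eq_integral => g _.
under eq_integral do rewrite dotv_split.
exact: integral_probability_cst.
Qed.

(* Density of N(b, c^2) with respect to N(0, 1). *)
Definition affine_density (c b t : R) : R :=
  c^-1 * expR (t ^+ 2 / 2 - ((t - b) / c) ^+ 2 / 2).

Lemma affine_density_ge0 c b t : 0 < c -> 0 <= affine_density c b t.
Proof. by move=> c0; rewrite mulr_ge0 ?expR_ge0// invr_ge0 ltW. Qed.

Lemma measurable_affine_density (c b : R) :
  measurable_fun [set: measurableTypeR R] (affine_density c b).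
Proof.
apply: measurable_funM => //; apply: measurableT_comp => //.
apply: measurable_funB; apply: measurable_funM => //; apply: measurable_funX => //.
by apply: measurable_funM => //; exact: measurable_funB.
Qed.

(** The map on the left sends the component [g] along [u] to [c * g + b] and fixes the orthogonal
    part, so splitting both sides along [u] leaves the formula on the line. *)
Lemma ge0_integral_std_gaussian_affine (c b : R) (f : 'rV[R]_d -> \bar R) :
  0 < c ->
  measurable_fun [set: 'rV[R]_d] f -> (forall z, 0 <= f z)%E ->
  (\int[std_gaussian R d]_z f (z + (b + (c - 1) * dotv u z) *: u)%R =
   \int[std_gaussian R d]_z (f z * (affine_density c b (dotv u z))%:E))%E.
Proof.
move=> c0 mf f0.
have mdot : measurable_fun [set: 'rV[R]_d] (fun z : 'rV[R]_d => dotv u z).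
  exact: measurable_dotv.
pose W (p : measurableTypeR R * 'rV[R]_d) := f (p.2 + (p.1 - dotv u p.2) *: u).
have mW : measurable_fun setT W.
  apply: measurableT_comp => //; apply: measurable_addv => //.
  apply: measurable_scalev => //; apply: measurable_funB => //.
  exact: measurable_dotv.
pose Q g := (\int[std_gaussian R d]_z W (g, z))%E.
have mQ : measurable_fun [set: measurableTypeR R] Q.
  by apply: (measurable_fun_fubini_tonelli_F W) => // p; exact: f0.
have Q0 g : (0 <= Q g)%E by apply: integral_ge0 => z _; exact: f0.
rewrite (ge0_integral_std_gaussian_split
  (f := fun z : 'rV[R]_d => f (z + (b + (c - 1) * dotv u z) *: u)) u1)//; last first.
  apply: measurableT_comp => //; apply: measurable_addv => //.
  apply: measurable_scalev => //; apply: measurable_funD => //.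
  exact: measurable_funM.
transitivity (\int[N]_g Q (c * g + b)%R)%E.
  apply: eq_integral => g _; apply: eq_integral => z _; rewrite /W/=; congr f.
  by rewrite dotv_split -addrA -scalerDl; congr (_ + _ *: _); ring.
rewrite ge0_integral_normal_affine//.
rewrite (ge0_integral_std_gaussian_split
  (f := fun z => (f z * (affine_density c b (dotv u z))%:E)%E) u1)//; first last.
- by move=> z; rewrite mule_ge0// lee_fin affine_density_ge0.
- apply: emeasurable_funM => //; apply/measurable_EFinP.
  apply: measurableT_comp mdot; exact: measurable_affine_density.
apply: eq_integral => g _.
rewrite -ge0_integralZr//; first last.
- by rewrite lee_fin affine_density_ge0.
- by move=> z _; exact: f0.
- exact: measurableT_comp.
by apply: eq_integral => z _; rewrite dotv_split.
Qed.

End std_gaussian_direction.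

(** * Gaussians with scalar covariance *)

Section gaussian_scalar.
Context {R : realType} {d : nat}.

(** A positive semidefinite root [A] satisfies (A - s)(A + s) = 0, and [A + s%:M] is invertible: a
    vector [v] in its kernel has <v, vA> + s <v, v> = 0 with both terms nonnegative. The default
    value of [xget] is excluded because [s%:M] is itself a root. *)
Lemma sqrtmx_scalar (s : R) : 0 < s -> sqrtmx (s ^+ 2)%:M = s%:M :> 'M[R]_d.
Proof.
move=> s0; rewrite /sqrtmx; case: xgetP => [A _ [_ Apos A2]|/(_ s%:M) []].
- have AsU : A + s%:M \in unitmx.
    rewrite -row_free_unit -kermx_eq0; apply/eqP/row_matrixP => i.
    rewrite row0; set v := row i _; apply: dotvv_eq0.
    have : v *m (A + s%:M) = 0 by rewrite -row_mul mulmx_ker row0.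
    rewrite mulmxDr mul_mx_scalar => vA.
    have : dotv (v *m A + s *: v) v = 0.
      by rewrite vA dotvC -(scale0r 0) dotvZr mul0r.
    rewrite dotvC dotvDr dotvZr (dotvC v) => h.
    have := Apos v; have := dotvv_ge0 v; nra.
  have : (A - s%:M) *m (A + s%:M) = 0.
    rewrite mulmxDr !mulmxDl A2 !mulNmx mul_mx_scalar mul_scalar_mx.
    by rewrite -scalar_mxM -expr2 addrA subrK subrr.
  move=> /(congr1 (fun B => B *m invmx (A + s%:M))).
  by rewrite mulmxK// mul0mx => /eqP; rewrite subr_eq0 => /eqP.
- split; first by rewrite tr_scalar_mx.
    by move=> v; rewrite mul_mx_scalar dotvZl mulr_ge0 ?dotvv_ge0// ltW.
  by rewrite -scalar_mxM -expr2.
Qed.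

Lemma ge0_integral_gaussian_scalar (a : 'rV[R]_d) (s : R)
    (f : 'rV[R]_d -> \bar R) : 0 < s ->
  measurable_fun [set: 'rV[R]_d] f -> (forall z, 0 <= f z)%E ->
  (\int[gaussian a (s ^+ 2)%:M]_z f z =
   \int[std_gaussian R d]_z f (a + s *: z)%R)%E.
Proof.
move=> s0 mf f0; rewrite ge0_integral_distribution// sqrtmx_scalar//.
by apply: eq_integral => z _; rewrite /= /affv mul_mx_scalar.
Qed.

End gaussian_scalar.

(** * Renyi divergences *)

(** Any explicit density agrees almost everywhere with the Radon-Nikodym derivative of the
    definition, so it may replace it under the integral. *)
Lemma renyi_density d (T : measurableType d) (R : realType) (q : R)
    (P nu : probability T R) (g : T -> R) :
  measurable_fun [set: T] g -> (forall x, 0 <= g x) ->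
  (forall A, measurable A -> P A = (\int[nu]_(x in A) (g x)%:E)%E) ->
  renyi q P nu =
    ((q - 1)^-1%:E * lne (\int[nu]_z (g z `^ q)%R%:E))%E.
Proof.
move=> mg g0 Pg; have Pnu : P `<< nu by exact: density_dominates mg Pg.
rewrite /renyi asboolT//; congr (_ * lne _)%E.
apply: ge0_ae_eq_integral => //.
- apply: (measurableT_comp (measurable_poweR q)).
  by apply: measurable_int; apply: Radon_Nikodym_integrable.
- apply/measurable_EFinP.
  exact: measurableT_comp (measurable_powR q) mg.
- by move=> z _; exact: poweR_ge0.
- by move=> z _; rewrite lee_fin powR_ge0.
- by apply: filterS (ae_eq_density mg Pg) => z /= h zT; rewrite h// poweR_EFin.
Qed.

(** This is R_q(N(b, c^2) || N(0,1)). The q-th power of the density is again the exponential of a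
    quadratic, with coefficients [A], [B] and constant [K]; [c <= 1] ensures [V > 0], hence
    convergence. *)
Lemma renyi_affine_density (R : realType) (q c b : R) : 1 < q -> 0 < c <= 1 ->
  let V := c ^+ 2 + q * (1 - c ^+ 2) in
  (((q - 1)^-1)%:E *
    lne (\int[normal_prob (0 : R) 1]_t (affine_density c b t `^ q)%R%:E) =
  (q * b ^+ 2 / (2 * V) - ln c - ln V / (2 * (q - 1)))%:E)%E.
Proof.
move=> q1 /andP[c0 c1] V.
have V0 : 0 < V.
  rewrite ltr_wpDr ?exprn_gt0// mulr_ge0 ?(ltW (lt_trans ltr01 q1))//.
  by rewrite subr_ge0 exprn_ile1// ltW.
pose A := q * (c ^- 2 - 1); pose B := q * b / c ^+ 2.
have AV : 1 + A = V / c ^+ 2 by rewrite /A /V; field; rewrite gt_eqF.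
have A1 : 0 < 1 + A by rewrite AV divr_gt0// exprn_gt0.
pose K := - q * ln c - q * b ^+ 2 / (2 * c ^+ 2).
transitivity (((q - 1)^-1)%:E * lne (\int[normal_prob (0 : R) 1]_t
    ((expR K)%:E * (expR (B * t - A * t ^+ 2 / 2))%:E)))%E.
  congr (_ * lne _)%E; apply: eq_integral => t _; rewrite -EFinM; congr EFin.
  rewrite -expRD /affine_density -{1}(lnK c0) -expRN -expRD -expRM; congr expR.
  by rewrite /K /A /B; field; rewrite gt_eqF.
rewrite ge0_integralZl//; last first.
  apply/measurable_EFinP; apply: measurableT_comp => //.
  apply: measurable_funB; apply: measurable_funM => //.
  by apply: measurable_funM => //; exact: measurable_funX.
rewrite integral_normal_expR_quadratic; last by lra.
rewrite -EFinM lne_EFin; last first.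
  by rewrite !mulr_gt0 ?expR_gt0// invr_gt0 sqrtr_gt0.
rewrite -EFinM; congr EFin.
rewrite !lnM ?posrE ?mulr_gt0 ?expR_gt0 ?invr_gt0 ?sqrtr_gt0//.
rewrite !expRK lnV ?posrE ?sqrtr_gt0// -powR12_sqrt ?ltW// ln_powR AV.
rewrite ln_div ?posrE ?exprn_gt0// lnXn// /K /B mulr2n.
have q1' : q - 1 != 0 by rewrite gt_eqF// subr_gt0.
have c_neq0 : c != 0 by rewrite gt_eqF.
have V_neq0 : V != 0 by rewrite gt_eqF.
(* The terms in [b ^+ 2] combine with a factor [q - V]; this identity cancels both [q - 1] and
   [c ^+ 2]. *)
have Vq : q - V = (q - 1) * c ^+ 2 by rewrite /V; ring.
transitivity ((q - 1)^-1 * (q * b ^+ 2 * (q - V) / (2 * c ^+ 2 * V))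
  - ln c - ln V / (2 * (q - 1))); first by field; rewrite c_neq0 V_neq0 q1'.
by rewrite Vq; field; rewrite c_neq0 V_neq0 q1'.
Qed.

(** * The displaced Gaussian *)

Section displaced_gaussian.
Context {R : realType} {d : nat}.
Variables (sigma w : R) (x : 'rV[R]_d).
Hypotheses (sigma0 : 0 < sigma) (m0 : 0 < enorm x).
Let m := enorm x.
Let u := m^-1 *: x.

Let u1 : dotv u u = 1.
Proof. by rewrite /u dotvZl dotvZr -enorm_sq -/m; field; rewrite gt_eqF. Qed.

(** Since <u, x> = m, the term [- beta * m] of [alpha] removes the mean of beta <u, X>, leaving a
    centred fluctuation around [muD]. *)
Lemma displacementE (beta : R) z : displacement sigma w x beta (x + sigma *: z) =
  (muD sigma w beta + beta * sigma * dotv u z) *: u.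
Proof.
rewrite /displacement -/m -/u dotvDr dotvZr.
have -> : dotv u x = m by rewrite /u dotvZl -enorm_sq -/m; field; rewrite gt_eqF.
by congr (_ *: _); rewrite /alpha -/m; ring.
Qed.

(** The coefficient is kept as [1 - beta - 1] to match [ge0_integral_std_gaussian_affine] at
    [c = 1 - beta]. *)
Let displacedE (beta : R) z : displaced sigma w x beta (x + sigma *: z) =
  sigma *: (z + ((m - muD sigma w beta) / sigma + (1 - beta - 1) * dotv u z) *: u).
Proof.
have xE : x = m *: u by rewrite /u scalerA mulfV ?scale1r// gt_eqF.
rewrite /displaced displacementE {1}xE (addrC (m *: u)) -addrA -scalerBl.
rewrite (scalerDr sigma z) (scalerA sigma _ u); congr (_ + _ *: _).
by field; rewrite gt_eqF.
Qed.

Let msigma : measurable_fun [set: 'rV[R]_d] (fun z : 'rV[R]_d => sigma *: z).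
Proof. exact: measurable_scalev. Qed.

Lemma mu_beta_density (beta : R) (A : set 'rV[R]_d) :
  beta < 1 -> measurable A ->
  mu_beta sigma w x beta A =
  (\int[gaussian (0 : 'rV[R]_d) (sigma ^+ 2)%:M]_(y in A)
    (affine_density (1 - beta) ((m - muD sigma w beta) / sigma)
       (dotv u y / sigma))%:E)%E.
Proof.
move=> b1 mA; have c0 : 0 < 1 - beta by rewrite subr_gt0.
pose h := affine_density (1 - beta) ((m - muD sigma w beta) / sigma).
have h0 t : 0 <= h t by exact: affine_density_ge0.
have mh : measurable_fun [set: 'rV[R]_d] (fun y => h (dotv u y / sigma)).
  apply: measurableT_comp; first exact: measurable_affine_density.
  by apply: measurable_funM => //; exact: measurable_dotv.
have mind : measurable_fun [set: 'rV[R]_d] (fun y => (\1_A y : R)%:E).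
  by apply/measurable_EFinP; exact: measurable_indic.
have ind0 y : (0 <= (\1_A y : R)%:E)%E by rewrite lee_fin.
transitivity (\int[mu_beta sigma w x beta]_y (\1_A y)%:E)%E.
  by rewrite integral_indic// setIT.
rewrite ge0_integral_distribution//.
rewrite ge0_integral_gaussian_scalar//; first last.
- by move=> z; exact: ind0.
- by apply: measurableT_comp => //; exact: measurable_displaced.
under eq_integral do rewrite /= displacedE.
rewrite (@ge0_integral_std_gaussian_affine R d u u1 _ _
  (fun z => (\1_A (sigma *: z))%:E))//; last first.
  exact: (measurableT_comp mind msigma).
rewrite [RHS]integral_mkcond ge0_integral_gaussian_scalar//; last 2 first.
- apply/(measurable_restrictT _ mA)/measurable_funTS.
  exact/measurable_EFinP.
- by move=> y; rewrite patchE; case: ifP => // _; rewrite lee_fin.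
apply: eq_integral => z _.
rewrite add0r epatch_indic dotvZr mulrAC mulfV ?gt_eqF// mul1r muleC.
by [].
Qed.

(** The density of [mu_beta] depends on [y] only through [dotv u y / sigma], which is N(0,1) under
    the reference Gaussian; this leaves the divergence on the line. *)
Lemma JfunE (q beta : R) : 1 < q -> 0 <= beta < 1 ->
  let c := 1 - beta in
  let V := c ^+ 2 + q * (1 - c ^+ 2) in
  Jfun q sigma w x beta =
  (q * ((m - muD sigma w beta) / sigma) ^+ 2 / (2 * V)
    - ln c - ln V / (2 * (q - 1)))%:E.
Proof.
move=> q1 /andP[b0 b1] c V.
have c01 : 0 < c <= 1 by rewrite subr_gt0 b1 gerBl.
have /andP[c0 _] := c01.
rewrite -renyi_affine_density//; set b := _ / sigma.
have mh : measurable_fun [set: 'rV[R]_d]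
    (fun y : 'rV[R]_d => affine_density c b (dotv u y / sigma)).
  apply: measurableT_comp; first exact: measurable_affine_density.
  by apply: measurable_funM => //; exact: measurable_dotv.
rewrite /Jfun (renyi_density q mh); last 2 first.
- by move=> y; exact: affine_density_ge0.
- by move=> A mA; exact: mu_beta_density.
congr (_ * lne _)%E.
rewrite ge0_integral_gaussian_scalar//; last 2 first.
- by apply/measurable_EFinP; exact: measurableT_comp (measurable_powR q) mh.
- by move=> y; rewrite lee_fin powR_ge0.
rewrite -(ge0_integral_std_gaussian_dotv u1); last 2 first.
- apply/measurable_EFinP; apply: measurableT_comp (measurable_powR q) _.
  exact: measurable_affine_density.
- by move=> y; rewrite lee_fin powR_ge0.
apply: eq_integral => z _.
by rewrite add0r dotvZr mulrAC mulfV ?gt_eqF// mul1r.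
Qed.

(** This is [1 + A] for the quadratic exponent |D|^2 / w^2, so its positivity is the integrability
    condition. *)
Let disp_ratio (beta : R) := 1 - 2 * beta ^+ 2 * sigma ^+ 2 / w ^+ 2.

Lemma muD_sq (beta : R) : 0 < w -> 0 <= disp_ratio beta ->
  0 <= ln 2 + 2^-1 * ln (disp_ratio beta) ->
  muD sigma w beta ^+ 2 =
    w ^+ 2 * disp_ratio beta * (ln 2 + 2^-1 * ln (disp_ratio beta)).
Proof.
move=> w0 r0 l0.
have E : w ^+ 2 - 2 * beta ^+ 2 * sigma ^+ 2 = w ^+ 2 * disp_ratio beta.
  by rewrite /disp_ratio; field; rewrite gt_eqF.
by rewrite /muD -/(disp_ratio beta) E sqr_sqrtr// mulr_ge0// mulr_ge0// sqr_ge0.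
Qed.

(** With r the ratio and D = [muD], the quadratic formula gives r^(-1/2) exp(D^2 / (w^2 r)).
    Equating this to 2 and solving for D^2 yields exactly the radicand defining [muD]. *)
Lemma integral_normal_displacement (beta : R) : 0 < w -> 0 < disp_ratio beta ->
  0 <= ln 2 + 2^-1 * ln (disp_ratio beta) ->
  (\int[normal_prob (0 : R) 1]_t
    (expR (((muD sigma w beta + beta * sigma * t) / w) ^+ 2))%:E = 2%:E)%E.
Proof.
move=> w0 r0 l0; set r := disp_ratio beta; set D := muD sigma w beta.
have D2 : D ^+ 2 = w ^+ 2 * r * (ln 2 + 2^-1 * ln r).
  by rewrite /D muD_sq// ltW.
have w_neq0 : w != 0 by rewrite gt_eqF.
have r_neq0 : r != 0 by rewrite gt_eqF.
pose B := 2 * D * beta * sigma / w ^+ 2.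
have rE : 1 + (r - 1) = r by ring.
transitivity (\int[normal_prob (0 : R) 1]_t
  ((expR (D ^+ 2 / w ^+ 2))%:E * (expR (B * t - (r - 1) * t ^+ 2 / 2))%:E))%E.
  apply: eq_integral => t _; rewrite -EFinM -expRD; congr (expR _)%:E.
  by rewrite /B /r /disp_ratio; field.
rewrite ge0_integralZl//; last first.
  apply/measurable_EFinP; apply: measurableT_comp => //.
  apply: measurable_funB; apply: measurable_funM => //.
  by apply: measurable_funM => //; exact: measurable_funX.
rewrite integral_normal_expR_quadratic; last by rewrite ltrBrDr addNr.
rewrite rE -EFinM mulrCA -expRD.
have -> : D ^+ 2 / w ^+ 2 + B ^+ 2 / (2 * r) = ln 2 + 2^-1 * ln r.
  rewrite /B.
  transitivity (D ^+ 2 / (w ^+ 2 * r) * (r + 2 * beta ^+ 2 * sigma ^+ 2 / w ^+ 2)).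
    by field; rewrite ?w_neq0 ?r_neq0.
  have -> : r + 2 * beta ^+ 2 * sigma ^+ 2 / w ^+ 2 = 1.
    by rewrite /r /disp_ratio subrK.
  by rewrite D2; field; rewrite ?w_neq0 ?r_neq0.
rewrite expRD lnK ?posrE// -ln_powR powR12_sqrt ?ltW//.
rewrite lnK ?posrE ?sqrtr_gt0// mulrCA mulVf ?mulr1//.
by rewrite gt_eqF ?sqrtr_gt0.
Qed.

End displaced_gaussian.

(** * The coupling of X with X - D and its Orlicz norm *)

Definition with_displaced (R : realType) (d : nat) (sigma w : R) (x : 'rV[R]_d)
    (beta : R) (X : 'rV[R]_d) : 'rV[R]_d * 'rV[R]_d :=
  (X, displaced sigma w x beta X).

Lemma measurable_with_displaced (R : realType) (d : nat) (sigma w : R)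
    (x : 'rV[R]_d) (beta : R) :
  measurable_fun [set: 'rV[R]_d] (with_displaced sigma w x beta).
Proof. by apply: measurable_fun_pair => //; exact: measurable_displaced. Qed.

HB.instance Definition _ (R : realType) (d : nat) (sigma w : R)
    (x : 'rV[R]_d) (beta : R) :=
  isMeasurableFun.Build _ _ _ _ (with_displaced sigma w x beta)
    (measurable_with_displaced sigma w x beta).

(** Under the law [p] of (X, X - D) the difference is D, and [lambda = w] is admissible in the
    Orlicz norm because E exp(|D|^2 / w^2) - 1 = 1. *)
Lemma Wpsi_mu_beta (R : realType) (d : nat) (sigma w beta : R) (x : 'rV[R]_d) :
  0 < sigma -> 0 < enorm x -> 0 < w ->
  0 < 1 - 2 * beta ^+ 2 * sigma ^+ 2 / w ^+ 2 ->
  0 <= ln 2 + 2^-1 * ln (1 - 2 * beta ^+ 2 * sigma ^+ 2 / w ^+ 2) ->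
  (Wpsi (gaussian x (sigma ^+ 2)%:M) (mu_beta sigma w x beta) <= w%:E)%E.
Proof.
move=> sigma0 m0 w0 r0 l0.
pose p :=
  distribution (gaussian x (sigma ^+ 2)%:M) (with_displaced sigma w x beta).
apply: (@le_trans _ _ (orlicz_norm p (fun z => z.1 - z.2))).
  by apply: ereal_inf_lbound; exists p.
apply: ereal_inf_lbound; exists w => //; split => //.
have psi2_ge0 (t : R) : 0 <= psi2 t by rewrite subr_ge0 -expR0 ler_expR sqr_ge0.
have mpsi2 : measurable_fun [set: R] (@psi2 R).
  by apply: measurable_funB => //; exact: measurableT_comp.
have menorm : measurable_fun [set: 'rV[R]_d] (@enorm R d).
  have msqrt : measurable_fun [set: R] (@Num.sqrt R).
    by apply: continuous_measurable_fun; exact: sqrt_continuous.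
  apply: (measurableT_comp msqrt).
  by apply: measurable_sum => i; apply: measurable_funM; exact: measurable_coord.
pose f (v : 'rV[R]_d) := (psi2 (enorm v / w))%:E.
have mf : measurable_fun [set: 'rV[R]_d] f.
  apply/measurable_EFinP; apply: measurableT_comp => //.
  exact: measurable_funM.
pose F (z : 'rV[R]_d * 'rV[R]_d) := f (z.1 - z.2).
have mF : measurable_fun setT F.
  apply: measurableT_comp => //; apply: measurable_addv => //.
  under eq_fun do rewrite -scaleN1r.
  exact: measurable_scalev.
have mmu (X : 'rV[R]_d) : F (with_displaced sigma w x beta X) =
    f (displacement sigma w x beta X).
  by rewrite /F/= /displaced opprB addrC subrK.
pose u := (enorm x)^-1 *: x.
have u1 : dotv u u = 1.
  by rewrite /u dotvZl dotvZr -enorm_sq; field; rewrite gt_eqF.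
pose g (t : R) := ((muD sigma w beta + beta * sigma * t) / w) ^+ 2.
have mg : measurable_fun [set: measurableTypeR R] (fun t => (expR (g t))%:E).
  apply/measurable_EFinP; apply: measurableT_comp => //.
  apply: measurable_funX; apply: measurable_funM => //.
  by apply: measurable_funD => //; exact: measurable_funM.
have g1 t : 0 <= expR (g t) - 1 by rewrite subr_ge0 -expR0 ler_expR sqr_ge0.
have mg1 : measurable_fun [set: measurableTypeR R]
    (fun t => (expR (g t) - 1)%:E).
  apply/measurable_EFinP; apply: measurable_funB => //.
  exact/measurable_EFinP.
rewrite unlock -[X in (X <= _)%E]/(\int[p]_z F z)%E.
rewrite ge0_integral_distribution//; last by move=> z; rewrite lee_fin.
rewrite ge0_integral_gaussian_scalar//; first last.
- by move=> z; rewrite lee_fin.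
- by apply: measurableT_comp => //; exact: measurable_with_displaced.
have -> : (\int[std_gaussian R d]_z
    (F \o with_displaced sigma w x beta) (x + sigma *: z)%R =
    \int[std_gaussian R d]_z (expR (g (dotv u z)) - 1)%:E)%E.
  apply: eq_integral => z _; rewrite [LHS]mmu displacementE// -/u /f enormZ.
  rewrite /enorm u1 sqrtr1 mulr1 /psi2 /g.
  by rewrite [in LHS]exprMn real_normK ?num_real// -exprMn.
rewrite (ge0_integral_std_gaussian_dotv u1 (f := fun t => (expR (g t) - 1)%:E))//.
have I2 : (\int[normal_prob (0 : R) 1]_t (expR (g t))%:E = 2%:E)%E.
  exact: integral_normal_displacement.
(* Adding 1, as the integral of a constant, to both sides reduces the bound to the exponential
   integral without subtracting integrals. *)
rewrite -(@leeD2rE _ 1%E)//.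
rewrite -[X in (_ + X <= _)%E](@integral_probability_cst R _ _
  (normal_prob (0 : R) 1) 1%E) -ge0_integralD//; last first.
  by move=> t _; rewrite lee_fin.
under eq_integral do rewrite -EFinD subrK.
by rewrite I2 -EFinD lee_fin.
Qed.

(** * The derivative at zero *)

Section pointwise_derivatives.
Context {R : realType}.
Variables (x : R) (f g : R -> R) (df dg : R).
Hypotheses (hf : is_derive x 1 f df) (hg : is_derive x 1 g dg).

(** The rules are stated for explicit pointwise expressions so that the derivative of a long formula
    can be assembled as one term. *)
Lemma is_derive_funD : is_derive x 1 (fun t => f t + g t) (df + dg).
Proof. exact: is_deriveD. Qed.

Lemma is_derive_funB : is_derive x 1 (fun t => f t - g t) (df - dg).
Proof. exact: is_deriveB. Qed.

Lemma is_derive_funM :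
  is_derive x 1 (fun t => f t * g t) (f x * dg + g x * df).
Proof. exact: is_deriveM. Qed.

Lemma is_derive_funV : f x != 0 ->
  is_derive x 1 (fun t => (f t)^-1) (- (f x) ^- 2 * df).
Proof. by move=> fx0; exact: is_deriveV. Qed.

Lemma is_derive_fun_ln : 0 < f x ->
  is_derive x 1 (fun t => ln (f t)) ((f x)^-1 * df).
Proof.
by move=> fx0; have lnd := is_derive1_ln fx0; exact: is_derive1_comp.
Qed.

Lemma is_derive_fun_sqrt : 0 < f x ->
  is_derive x 1 (fun t => Num.sqrt (f t)) ((2 * Num.sqrt (f x))^-1 * df).
Proof.
by move=> fx0; have sqrtd := is_derive1_sqrt fx0; exact: is_derive1_comp.
Qed.

End pointwise_derivatives.

(** The closed formulas below are differentiable on both sides of 0, so the one-sided limit is a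
    restriction of the two-sided one. *)
Lemma is_derive_right_cvg {R : realType} (f : R -> R) (df : R) :
  is_derive (0 : R) 1 f df -> (f b - f 0) / (b - 0) @[b --> 0^'+] --> df.
Proof.
move=> [df0 <-]; apply: cvg_dnbhs_at_right.
have -> : (fun b : R => (f b - f 0) / (b - 0)) =
    (fun h => h^-1 *: ((f \o shift 0) (h *: 1) - f 0)).
  apply/funext => h /=; rewrite subr0 addr0 mulrC.
  by congr (_ * (f _ - _)); rewrite [RHS]mulr1.
exact: df0.
Qed.

(** * The Renyi divergence as an explicit function of beta *)

Section renyi_curve.
Context {R : realType}.
Variables (q sigma w m : R).
Hypotheses (q1 : 1 < q) (sigma0 : 0 < sigma) (w0 : 0 < w).
Let s := w * Num.sqrt (ln 2).

(* R_q(N(m - muD, c^2 sigma^2) || N(0, sigma^2)) *)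
Definition renyi_curve (beta : R) : R :=
  let c := 1 - beta in
  let V := c ^+ 2 + q * (1 - c ^+ 2) in
  q * ((m - muD sigma w beta) / sigma) ^+ 2 / (2 * V)
    - ln c - ln V / (2 * (q - 1)).

Lemma muD0 : muD sigma w 0 = s.
Proof.
rewrite /muD expr0n !(mulr0, mul0r) !subr0 ln1 mulr0 addr0.
by rewrite sqrtrM ?sqr_ge0// sqrtr_sqr gtr0_norm.
Qed.

Lemma renyi_curve0 : renyi_curve 0 = q * (m - s) ^+ 2 / (2 * sigma ^+ 2).
Proof.
rewrite /renyi_curve muD0 subr0 expr1n subrr mulr0 addr0 ln1 mul0r !subr0 mulr1.
by field; rewrite gt_eqF.
Qed.

Let d_id : is_derive (0 : R) 1 (fun t => t) 1.
Proof. exact: is_derive_id. Qed.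

Let d_cst (k : R) : is_derive (0 : R) 1 (fun=> k) 0.
Proof. exact: is_derive_cst. Qed.

(** The radicand depends on beta only through its square, and equals w^2 ln 2 > 0 at 0, where the
    square root is therefore differentiable. *)
Lemma is_derive_muD0 : is_derive (0 : R) 1 (muD sigma w) 0.
Proof.
have ln2_gt0 : 0 < ln (2 : R) by rewrite ln_gt0 ?ltr1n.
have de : is_derive (0 : R) 1 (fun b => 2 * b ^+ 2 * sigma ^+ 2) 0.
  apply: is_derive_eq (is_derive_funM (is_derive_funM (d_cst 2)
    (is_derive_funM d_id d_id)) (d_cst (sigma ^+ 2))) _.
  by rewrite /=; ring.
pose r b := 1 - 2 * b ^+ 2 * sigma ^+ 2 / w ^+ 2.
have r0 : r 0 = 1 by rewrite /r expr0n/= mulr0 !mul0r subr0.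
have dr : is_derive (0 : R) 1 r 0.
  apply: is_derive_eq (is_derive_funB (d_cst 1)
    (is_derive_funM de (d_cst (w ^+ 2)^-1))) _.
  by rewrite /=; ring.
have r0_gt0 : 0 < r 0 by rewrite r0.
have dE := is_derive_funM (is_derive_funB (d_cst (w ^+ 2)) de)
  (is_derive_funD (d_cst (ln 2))
    (is_derive_funM (d_cst 2^-1) (is_derive_fun_ln dr r0_gt0))).
apply: is_derive_eq (is_derive_fun_sqrt dE _) _ => /=.
  rewrite expr0n/= !(mulr0, mul0r) r0 ln1 mulr0 subr0 addr0.
  by rewrite mulr_gt0// exprn_gt0.
by rewrite !(mulr0, addr0, subr0).
Qed.

(** At 0 one has c = V = 1, V' = 2 (q - 1) and [muD] stationary. The two logarithmic terms
    contribute 1 and -1 and cancel; only the factor 1 / V of the mean term remains. *)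
Lemma is_derive_renyi_curve0 :
  is_derive (0 : R) 1 renyi_curve (- (q * (q - 1) * (m - s) ^+ 2 / sigma ^+ 2)).
Proof.
have q1' : q - 1 != 0 by rewrite gt_eqF// subr_gt0.
have s_neq0 : sigma != 0 by rewrite gt_eqF.
pose V (b : R) := (1 - b) ^+ 2 + q * (1 - (1 - b) ^+ 2).
have V0 : V 0 = 1 by rewrite /V; ring.
have dc : is_derive (0 : R) 1 (fun b => 1 - b) (0 - 1).
  exact: (is_derive_funB (d_cst 1) d_id).
have dc2 := is_derive_funM dc dc.
have dV : is_derive (0 : R) 1 V (2 * (q - 1)).
  apply: is_derive_eq (is_derive_funD dc2
    (is_derive_funM (d_cst q) (is_derive_funB (d_cst 1) dc2))) _.
  by rewrite /=; ring.
have da := is_derive_funM (is_derive_funB (d_cst m) is_derive_muD0)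
  (d_cst sigma^-1).
have d2V := is_derive_funM (d_cst 2) dV.
have V2_neq0 : 2 * V 0 != 0 by rewrite V0 mulr1.
have V0_gt0 : 0 < V 0 by rewrite V0.
have c0_gt0 : (0 : R) < 1 - 0 by rewrite subr0.
apply: is_derive_eq (is_derive_funB (is_derive_funB
  (is_derive_funM (is_derive_funM (d_cst q) (is_derive_funM da da))
    (is_derive_funV d2V V2_neq0)) (is_derive_fun_ln dc c0_gt0))
  (is_derive_funM (is_derive_fun_ln dV V0_gt0) (d_cst (2 * (q - 1))^-1))) _.
rewrite /= V0 muD0; field.
by rewrite s_neq0 q1'.
Qed.

End renyi_curve.

(** * Strict improvement over the constant shift by s *)

Theorem theorem8 (R : realType) (d : nat) (q sigma w : R) (x : 'rV[R]_d) :
  (1 <= d)%N -> 1 < q -> 0 < sigma -> 0 < w ->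
  let m := enorm x in
  let s := w * Num.sqrt (ln 2) in
  0 < s -> s < m ->
  let mu := gaussian x (sigma ^+ 2)%:M in
  let nu := gaussian (0 : 'rV[R]_d) (sigma ^+ 2)%:M in
  let mu0 := m - s in
  let J := Jfun q sigma w x in
  [/\ is_right_derive J 0 (- (q * (q - 1) * mu0 ^+ 2 / sigma ^+ 2)),
      - (q * (q - 1) * mu0 ^+ 2 / sigma ^+ 2) < 0,
      (\forall beta \near 0^'+,
        (shifted_renyi q w mu nu <= J beta)%E /\
        (J beta < (q * (m - s) ^+ 2 / (2 * sigma ^+ 2))%:E)%E)
    & shifted_renyi q w mu nu <>
        (q * Num.max (m - s) 0 ^+ 2 / (2 * sigma ^+ 2))%:E].
Proof.
move=> _ q1 sigma0 w0 m s s0 sm mu nu mu0 J.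
have m0 : 0 < m by exact: lt_trans sm.
have mu0_gt0 : 0 < mu0 by rewrite subr_gt0.
have JE beta : 0 <= beta < 1 -> J beta = (renyi_curve q sigma w m beta)%:E.
  by move=> b01; rewrite /J JfunE.
have J0 : J 0 = (renyi_curve q sigma w m 0)%:E by rewrite JE// lexx ltr01.
have JEnear : \forall beta \near 0^'+,
    J beta = (renyi_curve q sigma w m beta)%:E.
  near=> beta; apply: JE; apply/andP; split.
    by near: beta; exact: nbhs_right_ge.
  by near: beta; exact: nbhs_right_lt.
set l := - (q * (q - 1) * mu0 ^+ 2 / sigma ^+ 2).
have l_lt0 : l < 0.
  rewrite oppr_lt0 divr_gt0 ?exprn_gt0// mulr_gt0 ?exprn_gt0//.
  by rewrite mulr_gt0 ?subr_gt0// (lt_trans ltr01).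
have dJ : (fine (J b) - fine (J 0)) / (b - 0) @[b --> 0^'+] --> l.
  have := is_derive_right_cvg (is_derive_renyi_curve0 m q1 sigma0 w0).
  apply: cvg_trans; apply: near_eq_cvg.
  by apply: filterS JEnear => b ->; rewrite J0.
(* With beta^2 <= beta, the last bound makes the ratio at least 1/2, so ln 2 + (1/2) ln r is at
   least (1/2) ln 2 and [muD] is the genuine root. *)
have W beta : 0 <= beta -> beta < 1 -> beta < w ^+ 2 / (4 * sigma ^+ 2) ->
    (shifted_renyi q w mu nu <= J beta)%E.
  move=> b0 b1 bw; apply: ereal_inf_lbound.
  exists (mu_beta sigma w x beta) => //=.
  have half : 2 * beta ^+ 2 * sigma ^+ 2 / w ^+ 2 <= 2^-1.
    move: bw; rewrite ltr_pdivlMr ?mulr_gt0 ?exprn_gt0// ; rewrite mulrCA => bw.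
    rewrite ler_pdivrMr ?exprn_gt0//.
    have : beta ^+ 2 * sigma ^+ 2 <= beta * sigma ^+ 2.
      by rewrite ler_pM2r ?exprn_gt0// expr2 ler_piMr// ltW.
    by move: bw; rewrite -[2 * _ * _]mulrA; lra.
  have r12 : 2^-1 <= 1 - 2 * beta ^+ 2 * sigma ^+ 2 / w ^+ 2 by lra.
  have r0 : 0 < 1 - 2 * beta ^+ 2 * sigma ^+ 2 / w ^+ 2 by lra.
  apply: Wpsi_mu_beta => //.
  have ln2 : 0 < ln (2 : R) by rewrite ln_gt0 ?ltr1n.
  have : ln 2^-1 <= ln (1 - 2 * beta ^+ 2 * sigma ^+ 2 / w ^+ 2).
    by rewrite ler_ln ?posrE.
  by rewrite lnV ?posrE//; lra.
(* Difference quotients tending to [l < 0] are eventually negative, and their denominators are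
   positive on the right of 0. *)
have lt_near : \forall beta \near 0^'+, (J beta < J 0%R)%E.
  near=> beta.
  have b0 : 0 < beta by near: beta; exact: nbhs_right_gt.
  have Jb : J beta = (renyi_curve q sigma w m beta)%:E by near: beta.
  have : (fine (J beta) - fine (J 0)) / (beta - 0) < 0.
    by near: beta; exact: cvgr_lt dJ _ _.
  by rewrite Jb J0 /= subr0 pmulr_llt0 ?invr_gt0// subr_lt0 lte_fin.
have near_main : \forall beta \near 0^'+,
    (shifted_renyi q w mu nu <= J beta)%E /\
    (J beta < (q * (m - s) ^+ 2 / (2 * sigma ^+ 2))%:E)%E.
  near=> beta; split.
    apply: W; near: beta; first exact: nbhs_right_ge.
      exact: nbhs_right_lt.
    by apply: nbhs_right_lt; rewrite divr_gt0 ?mulr_gt0 ?exprn_gt0.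
  by rewrite -renyi_curve0// -J0; near: beta.
split => //.
- split=> //; first by rewrite J0.
  by apply: filterS JEnear => b ->.
(* One small beta suffices: the claimed identity would give J(0) <= J(beta) < J(0), since [s < m]
   makes the maximum equal to [m - s]. *)
- move=> E.
  have [beta [le1 lt1]] :=
    @filter_ex _ _ (at_right_proper_filter (0 : R)) _ near_main.
  have := le_lt_trans le1 lt1.
  by rewrite E maxEge subr_ge0 (ltW sm) ltxx.
Unshelve. all: by end_near. Qed.
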